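(* For every countable dense group-like subset $D$ of $[0,\infty)$ there exist two non-homeomorphic good non-defective measures $\mu_1$ and $\mu_2$ on Cantor spaces $X_1$ and $X_2$ such that $S(\mu_1)=S(\mu_2)=D$.
   Context: A Cantor space is a non-empty zero-dimensional compact perfect metric space. A Borel measure on a Cantor space $X$ is full if every non-empty open set has positive measure. $M_\infty(X)$ is the set of all full non-atomic Borel measures $\mu$ on $X$ with $\mu(X)=\infty$. For $\mu\in M_\infty(X)$ the defective set is $\mathfrak{M}_\mu=\{x\in X:\mu(U)=\infty\text{ for every clopen }U\ni x\}$. $\mu$ is non-defective if $\mu(\mathfrak{M}_\mu)=0$. For a non-defective $\mu$ the clopen values set is $S(\mu)=\{\mu(U): U\text{ clopen in }X,\ \mu(U)<\infty\}$. A non-defective measure $\mu$ is good if whenever $U,V$ are clopen subsets of $X$ with $\mu(U)<\mu(V)$, there is a clopen $W\subset V$ with $\mu(W)=\mu(U)$. Measures $\mu_1$ on $X_1$ and $\mu_2$ on $X_2$ are homeomorphic if there is a homeomorphism $h\colon X_1\to X_2$ with $h_*\mu_1=\mu_2$. A dense countable unbounded subset $D\subset[0,\infty)$ is group-like if for every $\gamma\in D$ there is an additive subgroup $G$ of $\mathbb{R}$ such that $D\cap[0,\gamma]=G\cap[0,\gamma]$. *)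

(* Defs.v *)
From HB Require Import structures.
From mathcomp Require Import all_boot all_order all_algebra.
From mathcomp Require Import all_classical all_reals all_analysis.

Set Implicit Arguments.
Unset Strict Implicit.
Unset Printing Implicit Defensive.

Import Order.TTheory GRing.Theory Num.Theory.
Import numFieldNormedType.Exports.

Local Open Scope classical_set_scope.
Local Open Scope ring_scope.
Local Open Scope ereal_scope.

(* Pointed (hence non-empty) metric spaces: [g_sigma_algebraType] needs a
   pointed carrier. *)
#[short(type="pmetricType")]
HB.structure Definition PointedMetric (K : numDomainType) :=
  {M of Pointed M & Metric K M}.

Notation borel X := (g_sigma_algebraType (@open X)).

Section measures_on_topological_spaces.
Context {R : realType} {X : ptopologicalType}.
Implicit Types (mu : {measure set (borel X) -> \bar R}) (A B : set (borel X)).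

Definition full mu :=
  forall U : set X, open U -> U !=set0 -> 0 < mu U.

Definition atom mu A :=
  [/\ measurable A, 0 < mu A &
      forall B, measurable B -> B `<=` A -> mu B < mu A -> mu B = 0].

Definition nonatomic mu := forall A, ~ atom mu A.

Definition M_infty mu := [/\ full mu, nonatomic mu & mu [set: X] = +oo].

Definition defective_set mu : set X :=
  [set x | forall U : set X, clopen U -> U x -> mu U = +oo].

Definition nondefective mu := mu (defective_set mu) = 0.

Definition clopen_values mu : set R :=
  [set fine (mu U) | U in [set U : set X | clopen U /\ mu U < +oo]].

Definition good mu :=
  forall U V : set X, clopen U -> clopen V -> mu U < mu V ->
  exists W : set X, [/\ clopen W, W `<=` V & mu W = mu U].

End measures_on_topological_spaces.

Definition homeomorphism (X1 X2 : topologicalType) (h : X1 -> X2) :=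
  continuous h /\
  exists g : X2 -> X1, [/\ cancel h g, cancel g h & continuous g].

Definition homeomorphic_measures (R : realType) (X1 X2 : ptopologicalType)
    (mu1 : {measure set (borel X1) -> \bar R})
    (mu2 : {measure set (borel X2) -> \bar R}) :=
  exists h : X1 -> X2, homeomorphism h /\
    forall A : set (borel X2), measurable A ->
      pushforward mu1 (h : borel X1 -> borel X2) A = mu2 A.

(* Density is relative to the half-line, whence the closure in [R]. *)
Definition group_like (R : realType) (D : set R) :=
  [/\ D `<=` `[0%R, +oo[,
      countable D,
      `[0%R, +oo[ `<=` closure D,
      ~ has_ubound D &
      forall gamma, D gamma ->
        exists2 G : {pred R}, zmod_closed G &
          D `&` `[0%R, gamma] = [set` G] `&` `[0%R, gamma]].

(* Main.v *)
(* Write [G = D - D], a countable dense subgroup of [R] whose nonnegative part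
   is [D], and cut the line at every point of [G]: the space of upper sets of
   [G] (for the half-line: of upper sets of its positive part) is a Cantor space
   carrying the image of Lebesgue measure. Its clopen sets are the finite unions
   of intervals whose endpoints are in [G] or infinite, so the finite clopen
   values are the elements of [D], and goodness follows by filling these
   intervals one after the other. The defective points are the infinite ends:
   one for the half-line, two for the whole line, and a homeomorphism carrying
   one measure to the other would preserve their number. *)

From HB Require Import structures.
Require Import Defs.
From mathcomp Require Import all_boot all_order all_algebra.
From mathcomp Require Import all_classical all_reals all_analysis.
From mathcomp Require Import lra.

Set Implicit Arguments.
Unset Strict Implicit.
Unset Printing Implicit Defensive.

Import Order.TTheory GRing.Theory Num.Theory.
Import numFieldNormedType.Exports.

Local Open Scope classical_set_scope.
Local Open Scope ring_scope.

(* [x n] means that [q n] lies in the upper set; [bot] is [-oo] for the line and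
   [0] for the half-line. *)
Definition is_cut (R : realType) (q : nat -> R) (bot : \bar R)
    (x : nat -> bool) :=
  (forall m n, q m <= q n -> x m -> x n) /\
  (forall n, ((q n)%:E <= bot)%E -> ~~ x n).

Definition cuts (R : realType) (q : nat -> R) (bot : \bar R) :=
  {x : nat -> bool | is_cut q bot x}.

(** * The metric space of cuts: compactness and zero dimension *)

Section cut_metric.
Context {R : realType} (q : nat -> R) (bot : \bar R).
Local Notation X := (cuts q bot).
Implicit Types x y z : X.

Lemma cut_eqP x y : (forall n, sval x n = sval y n) -> x = y.
Proof.
case: x y => [x hx] [y hy] /= /funext xy; move: hx; rewrite xy => hx.
by congr exist; exact: Prop_irrelevance.
Qed.

HB.instance Definition _ := gen_eqMixin X.
HB.instance Definition _ := gen_choiceMixin X.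

Lemma is_cut_false : is_cut q bot (fun=> false).
Proof. by split. Qed.

Definition cut_top : X := exist _ _ is_cut_false.

HB.instance Definition _ := isPointed.Build X cut_top.

(** The first-difference metric of sequence space; indices start at 0, whence the successor. *)
Definition cut_dist x y : R :=
  if pselect (exists n, sval x n != sval y n) is left h
  then (ex_minn h).+1%:R^-1 else 0.

Variant cut_dist_spec x y : R -> Prop :=
| CutDistEq of x = y : cut_dist_spec x y 0
| CutDistNeq n of sval x n != sval y n &
    (forall m, (m < n)%N -> sval x m = sval y m) :
    cut_dist_spec x y n.+1%:R^-1.

Lemma cut_distP x y : cut_dist_spec x y (cut_dist x y).
Proof.
rewrite /cut_dist; case: pselect => [h|h].
  case: ex_minnP => n xyn nmin; apply: CutDistNeq => // m mn.
  by apply: contraTeq mn => xym; rewrite -leqNgt nmin.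
apply: CutDistEq; apply: cut_eqP => n; apply: contrapT => /eqP xyn.
by apply: h; exists n.
Qed.

Lemma cut_dist_ltP x y N :
  cut_dist x y < N.+1%:R^-1 <-> forall n, (n <= N)%N -> sval x n = sval y n.
Proof.
case: cut_distP => [->|n xyn nmin]; first by split=> // _; rewrite invr_gt0.
rewrite ltf_pV2 ?posrE// ltr_nat ltnS; split=> [Nn m mN|agree].
  by rewrite nmin// (leq_ltn_trans mN).
by rewrite ltnNge; apply: contra xyn => nN; apply/eqP/agree.
Qed.

Lemma cut_distxx x : cut_dist x x = 0.
Proof. by case: cut_distP => // n /eqP. Qed.

Lemma cut_dist_eq0 x y : cut_dist x y = 0 -> x = y.
Proof. by case: cut_distP => // n _ _ /eqP; rewrite invr_eq0 pnatr_eq0. Qed.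

Lemma cut_dist_ge0 x y : 0 <= cut_dist x y.
Proof. by case: cut_distP. Qed.

Lemma cut_dist_diff x y n : sval x n != sval y n -> n.+1%:R^-1 <= cut_dist x y.
Proof.
by move=> xyn; rewrite leNgt; apply: contra xyn => /cut_dist_ltP ->.
Qed.

Lemma cut_dist_sym x y : cut_dist x y = cut_dist y x.
Proof.
apply/eqP; rewrite eq_le; apply/andP; split.
  case: (cut_distP x y) => [_|n xyn _]; first exact: cut_dist_ge0.
  by rewrite cut_dist_diff// eq_sym.
case: (cut_distP y x) => [_|n xyn _]; first exact: cut_dist_ge0.
by rewrite cut_dist_diff// eq_sym.
Qed.

(** At the first index where [x] and [z] differ, [y] differs from one of them, so one summand
    already reaches the left-hand side. *)
Lemma cut_dist_triangle y x z : cut_dist x z <= cut_dist x y + cut_dist y z.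
Proof.
case: (cut_distP x z) => [_|n xzn _]; first by rewrite addr_ge0// cut_dist_ge0.
have [xyn|xyn] := eqVneq (sval x n) (sval y n).
  by rewrite ler_wpDl ?cut_dist_ge0// cut_dist_diff// -xyn.
by rewrite ler_wpDr ?cut_dist_ge0// cut_dist_diff.
Qed.

HB.instance Definition _ := isMetric.Build R X
  cut_distxx cut_dist_eq0 cut_dist_sym cut_dist_triangle.

Definition cylinder x N : set X :=
  [set y | forall n, (n < N)%N -> sval x n = sval y n].

Lemma nbhs_cylinderP x (A : set X) :
  nbhs x A <-> exists N, cylinder x N `<=` A.
Proof.
rewrite -nbhs_ballE; split=> [[e /= e0 xeA]|[N NA]].
  have [N /= _ /(_ N (leqnn N))] :=
    near_infty_natSinv_lt (PosNum e0).
  move=> /= Ne; exists N.+1 => y xy; apply: xeA; rewrite ballEmdist /=.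
  by apply: lt_trans Ne; apply/cut_dist_ltP => n nN; apply: xy.
exists N.+1%:R^-1; first by rewrite /= invr_gt0.
move=> y; rewrite ballEmdist /= => /cut_dist_ltP xy; apply: NA => n nN.
by apply: xy; exact: ltnW.
Qed.

Definition cut_coord n : set X := [set x : X | sval x n].

Lemma clopen_cut_coord n : clopen (cut_coord n).
Proof.
split; last (rewrite -[cut_coord n]setCK; apply: open_closedC);
  rewrite openE => x xn; apply/nbhs_cylinderP; exists n.+1 => y xy.
  by rewrite /cut_coord/= -xy.
by rewrite /cut_coord/= -xy.
Qed.

Lemma cuts_zero_dimensional : zero_dimensional X.
Proof.
move=> x y; case: (cut_distP x y) => [->|n xyn _ _]; first by rewrite eqxx.
move: xyn; case xn : (sval x n); case yn: (sval y n) => // _.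
  by exists (cut_coord n); split;
    [exact: clopen_cut_coord| |rewrite /cut_coord/= yn].
exists (~` cut_coord n); split.
- by apply: clopenC; [exact: set0|exact: clopen_cut_coord].
- by rewrite /cut_coord/= xn.
- by rewrite /cut_coord/= yn; exact.
Qed.

Lemma cuts_compact : compact [set: X].
Proof.
rewrite compact_ultra => F FU _.
(* An ultrafilter decides every coordinate, which yields its limit [x]; each clause of [is_cut]
   involves at most two coordinates and so passes to [x]. *)
pose x n := `[< F (cut_coord n) >].
have FN n : ~ F (cut_coord n) -> F (~` cut_coord n).
  by move=> Fn; case: (in_ultra_setVsetC (cut_coord n) FU).
have xcut : is_cut q bot x.
  split=> [m n qmn /asboolP Fm|n qn].
    apply/asboolP; apply: filterS Fm => y.
    by apply: (svalP y).1.
  apply/negP => /asboolP Fn; have [y] := filter_ex Fn.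
  by apply/negP/(svalP y).2.
exists (exist _ x xcut); split=> // A /nbhs_cylinderP[N NA].
apply: filterS NA _; elim: N => [|N ih].
  by apply: filterS filterT => y _ n.
have FN' : F [set y | x N = sval y N].
  have [xN|xN] := boolP (x N).
    by apply: filterS (asboolW xN) => y /=.
  move/asboolPn: (xN) => /FN; apply: filterS => y /negP/negbTE /= ->.
  exact/negbTE.
apply: filterS (filterI ih FN') => y [yih yN] n; rewrite ltnS leq_eqVlt.
by move=> /predU1P[->//|]; exact: yih.
Qed.

(** Otherwise there are pairs [f N] that agree up to [N] and are separated by [U]. At a cluster
    point [c] of the first components, some cylinder lies inside [U] or inside its complement, yet
    contains both members of a late pair. *)
Lemma clopen_finite_coords (U : set X) : clopen U ->
  exists N, forall x y, U x -> cylinder x N y -> U y.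
Proof.
move=> [oU cU]; apply: contrapT => nN.
have /choice[f fP] : forall N, exists xy : X * X,
    [/\ U xy.1, cylinder xy.1 N xy.2 & ~ U xy.2].
  move=> N; apply: contrapT => nxy; apply: nN; exists N => x y Ux xy.
  by apply: contrapT => Uy; apply: nxy; exists (x, y).
have [|c [_ clc]] := @cuts_compact ((fst \o f) @ \oo) _.
  by apply: filterS filterT => ?.
have [M cM] : exists M, cylinder c M `<=` U \/ cylinder c M `<=` ~` U.
  have [Uc|Uc] := pselect (U c).
    move: oU; rewrite openE => /(_ _ Uc)/nbhs_cylinderP[M]; exists M; by left.
  move: (closed_openC cU); rewrite openE => /(_ _ Uc)/nbhs_cylinderP[M].
  by exists M; right.
have [_ [[N /= MN <-] cN]] :
    ((fst \o f) @` [set N | (M <= N)%N]) `&` cylinder c M !=set0.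
  apply: clc; last by apply/nbhs_cylinderP; exists M.
  by exists M => // N /= MN; exists N.
have [U1 f12 U2] := fP N; case: cM => cM; last exact: cM U1.
apply: U2; apply: cM => n nM; rewrite cN// f12//.
exact: leq_trans nM MN.
Qed.

End cut_metric.

(** * The image of Lebesgue measure on the space of cuts *)

Section cut_measure.
Context {R : realType} (q : nat -> R) (bot : \bar R).
Local Notation X := (cuts q bot).
Implicit Types (x y z : X) (a b : \bar R).

Lemma cut_at_subproof (t : R) :
  is_cut q bot (fun n => (bot < (q n)%:E)%E && (t < q n)).
Proof.
split=> [m n qmn /andP[bm tm]|n qn].
  by rewrite (lt_le_trans bm) ?lee_fin// (lt_le_trans tm).
by rewrite negb_and -leNgt qn.
Qed.

(** The strict [t < q n] places the cut of [t = q n] just above [q n], so that intervals of cuts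
    pull back, from [bot] on, to intervals closed on the left and open on the right. *)
Definition cut_at (t : measurableTypeR R) : borel X :=
  exist _ _ (cut_at_subproof t).

(** [cut_at] sends all reals below [bot] to one cut, so they must be discarded before Lebesgue
    measure is pushed forward. *)
Definition base : set (measurableTypeR R) := [set t | (bot <= t%:E)%E].

Lemma measurable_base : measurable base.
Proof.
rewrite /base; case: bot => [r| |].
- rewrite (_ : [set _ | _] = `[r, +oo[%classic); first exact: measurable_itv.
  by apply/seteqP; split=> t; rewrite /= lee_fin in_itv /= andbT.
- by rewrite (_ : [set _ | _] = set0)//; apply/seteqP; split=> t.
- rewrite (_ : [set _ | _] = setT)//; apply/seteqP; split=> t //=.
  by rewrite leNye.
Qed.

(** An open set is the union of the cylinders of those finite words [s] that force membership in it
    ([det]), and there are countably many words. Each coordinate condition pulls back to a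
    half-line, the whole line or the empty set. *)
Lemma measurable_cut_at : measurable_fun setT cut_at.
Proof.
apply: (@measurability _ _ (measurableTypeR R) (borel X) setT cut_at
  (@open X)) => // _ [U oU <-]; rewrite setTI.
pose C (s : seq bool) : set (measurableTypeR R) :=
  \bigcap_(n in [set n | (n < size s)%N])
    [set t | sval (cut_at t) n = nth false s n].
have mC s : measurable (C s).
  apply: bigcap_measurableType => n _ /=.
  have [bn|bn] := boolP (bot < (q n)%:E)%E; last first.
    case: (nth _ _ _).
      by rewrite (_ : [set _ | _] = set0)//; apply/seteqP; split.
    by rewrite (_ : [set _ | _] = setT)//; apply/seteqP; split.
  have mq : measurable (`]-oo, (q n)[%classic : set (measurableTypeR R)).
    exact: measurable_itv.
  case: (nth _ _ _).
    rewrite (_ : [set _ | _] = `]-oo, (q n)[%classic); first exact: mq.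
    by apply/seteqP; split => t; rewrite /= in_itv.
  rewrite (_ : [set _ | _] = ~` `]-oo, (q n)[%classic).
    exact: measurableC mq.
  apply/seteqP; split => t; rewrite /= in_itv /=; first by move=> ->.
  by move/negP/negbTE.
pose det (s : seq bool) : bool := `[< forall y : X,
  (forall n, (n < size s)%N -> sval y n = nth false s n) -> U y >].
rewrite (_ : cut_at @^-1` U =
    \bigcup_(s : seq bool) if det s then C s else set0).
  apply: countable_bigcupT_measurable; first exact: countableP.
  by move=> s; case: ifP.
apply/seteqP; split=> [t Ut|t [s _]].
  have : nbhs (cut_at t : X) U by move: oU; rewrite openE; exact.
  move=> /nbhs_cylinderP[N NU]; exists (mkseq (sval (cut_at t)) N) => //.
  rewrite ifT.
    by move=> n; rewrite /= size_mkseq => nN; rewrite nth_mkseq.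
  apply/asboolP => y yt; apply: NU => n nN.
  by rewrite yt ?size_mkseq// nth_mkseq.
by case: ifP => // /asboolP Us Ct; apply: Us => n ns; exact: Ct.
Qed.

Definition cut_measure : set (borel X) -> \bar R :=
  pushforward (mrestr lebesgue_measure measurable_base) cut_at.

Let cut_measure0 : cut_measure set0 = 0%E.
Proof. by rewrite /cut_measure /pushforward preimage_set0 measure0. Qed.

Let cut_measure_ge0 A : (0 <= cut_measure A)%E.
Proof. by rewrite /cut_measure /pushforward /mrestr measure_ge0. Qed.

Let cut_measure_sigma_additive : semi_sigma_additive cut_measure.
Proof.
have mt := measurable_cut_at.
exact: (@measure_semi_sigma_additive _ _ _
  (pushforward (mrestr lebesgue_measure measurable_base) cut_at)).
Qed.

HB.instance Definition _ := isMeasure.Build _ _ _ cut_measure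
  cut_measure0 cut_measure_ge0 cut_measure_sigma_additive.

Lemma cut_measureE A :
  cut_measure A = lebesgue_measure (cut_at @^-1` A `&` base).
Proof. by []. Qed.

Lemma clopen_measurable (U : set X) : clopen U ->
  measurable (U : set (borel X)).
Proof. by move=> [oU _]; exact: sub_sigma_algebra. Qed.

End cut_measure.

(** * Intervals of cuts and their measure *)

Section cut_interval.
Context {R : realType} (q : nat -> R) (bot : \bar R).
Local Notation X := (cuts q bot).
Local Notation mu := (@cut_measure R q bot).
Implicit Types (x y z : X) (a b : \bar R).

Definition grid : set (\bar R) :=
  [set a | [\/ a = -oo, a = +oo | exists n, a = (q n)%:E]]%E.

Lemma grid_q n : grid (q n)%:E.
Proof. by apply: Or33; exists n. Qed.

Lemma grid_ninfty : grid -oo%E.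
Proof. exact: Or31. Qed.

Lemma grid_pinfty : grid +oo%E.
Proof. exact: Or32. Qed.

(** A cut lies below [q n] when its upper set contains [q n]. At [-oo] and at reals outside the
    range of [q] this set is empty. *)
Definition below b : set X :=
  [set x : X | b = +oo%E \/ exists2 n, b = (q n)%:E & sval x n].

Lemma below_q n x : below (q n)%:E x <-> sval x n.
Proof.
split=> [[//|[m [qnm] xm]]|xn]; last by right; exists n.
by apply: (svalP x).1 xm; rewrite qnm.
Qed.

Lemma below_pinfty : below +oo%E = setT.
Proof. by apply/seteqP; split=> x // _; left. Qed.

Lemma below_ninfty : below -oo%E = set0.
Proof. by apply/seteqP; split=> x // -[|[]]. Qed.

Lemma below_mono a b : grid b -> (a <= b)%E -> below a `<=` below b.
Proof.
move=> [->|->|[n ->]] ab x.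
- by move: ab; rewrite leeNy_eq => /eqP ->.
- by rewrite below_pinfty.
- case=> [aoo|[m am xm]]; first by move: ab; rewrite aoo.
  by apply/below_q; apply: (svalP x).1 xm; rewrite -lee_fin -am.
Qed.

Lemma below_bot : (bot < +oo)%E -> forall a, (a <= bot)%E -> below a = set0.
Proof.
move=> boty a abot; apply/seteqP; split=> x // [aoo|[n an xn]].
  by move: abot; rewrite aoo leNgt boty.
by have := (svalP x).2 n; rewrite -an xn => /(_ abot).
Qed.

Lemma clopen_below a : clopen (below a).
Proof.
have [[n an]|an] := pselect (exists n, a = (q n)%:E).
  rewrite (_ : below a = @cut_coord _ q bot n); first exact: clopen_cut_coord.
  by apply/seteqP; split=> x; rewrite an => /below_q.
have [->|aoo] := eqVneq a +oo%E; first by rewrite below_pinfty; exact: clopenT.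
rewrite (_ : below a = set0); first exact: clopen0.
apply/seteqP; split=> x // [/eqP|[n ? _]]; first by rewrite (negbTE aoo).
by apply: an; exists n.
Qed.

Definition cut_itv a b : set X := below b `\` below a.

Lemma clopen_cut_itv a b : clopen (cut_itv a b).
Proof.
apply: clopenI; first exact: clopen_below.
by apply: clopenC; [exact: set0|exact: clopen_below].
Qed.

Lemma cut_itv_lt a b x : grid a -> cut_itv a b x -> (a < b)%E.
Proof.
move=> ga [xb xa]; rewrite ltNge; apply/negP => ba; apply: xa.
exact: below_mono ba _ xb.
Qed.

Lemma below_cut_at t b : base bot t -> grid b ->
  below b (cut_at q bot t) <-> (t%:E < b)%E.
Proof.
move=> bt [->|->|[n ->]].
- by rewrite below_ninfty; split=> //; rewrite ltNge leNye.
- by rewrite below_pinfty ltry.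
- rewrite below_q /= lte_fin; split=> [/andP[]//|tq].
  by rewrite tq andbT (le_lt_trans bt)// lte_fin.
Qed.

Lemma cut_itv_cut_at t a b : base bot t -> grid a -> grid b ->
  cut_itv a b (cut_at q bot t) <-> (a <= t%:E < b)%E.
Proof.
move=> bt ga gb; rewrite /cut_itv /=; split.
  move=> [/(below_cut_at bt gb) -> /(below_cut_at bt ga)/negP].
  by rewrite -leNgt => ->.
move=> /andP[]; rewrite leNgt => /negP at_ tb.
by split; [exact/below_cut_at|move/(below_cut_at bt ga)].
Qed.

Lemma lebesgue_measure_eitv a b :
  lebesgue_measure [set t : measurableTypeR R | (a <= t%:E < b)%E] =
  (if a < b then b - a else 0)%E.
Proof.
have nil A : A = set0 -> @lebesgue_measure R A = 0%E.
  by move=> ->; exact: measure0.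
have itvE (i : interval R) (A : set (measurableTypeR R)) : A = [set` i] ->
    lebesgue_measure A = (if i.1 < i.2 then (i.2 : \bar R) - i.1 else 0)%E.
  by move=> ->; exact: lebesgue_measure_itv.
case: a => [a| |]; case: b => [b| |].
- rewrite (itvE `[a, b[)//; apply/seteqP; split=> t /=;
  by rewrite in_itv/= lee_fin lte_fin.
- rewrite (itvE `[a, +oo[)//=; apply/seteqP; split=> t /=;
  by rewrite in_itv/= lee_fin ltry.
- by rewrite nil//; apply/seteqP; split=> t //=; rewrite ltNge leNye andbF.
- by rewrite nil//; apply/seteqP; split=> t //=.
- by rewrite nil//; apply/seteqP; split=> t //=.
- by rewrite nil//; apply/seteqP; split=> t //=.
- rewrite (itvE `]-oo, b[)//=; apply/seteqP; split=> t /=;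
  by rewrite in_itv/= lte_fin leNye.
- rewrite (itvE `]-oo, +oo[)//=; apply/seteqP; split=> t //=;
  by rewrite leNye ltry.
- by rewrite nil//; apply/seteqP; split=> t //=; rewrite ltNge leNye andbF.
Qed.

(** Thanks to [bot <= a] the preimage [[a, b[] lies inside [base], so restricting Lebesgue measure
    does not shorten it. *)
Lemma cut_measure_itv a b : grid a -> grid b -> (bot <= a)%E ->
  mu (cut_itv a b) = (if a < b then b - a else 0)%E.
Proof.
move=> ga gb ba; rewrite cut_measureE -lebesgue_measure_eitv.
congr lebesgue_measure; apply/seteqP; split=> t.
  by move=> [+ bt] => /cut_itv_cut_at; exact.
move=> /andP[at_ tb]; have bt : base bot t := le_trans ba at_.
by split=> //; apply/cut_itv_cut_at => //; apply/andP.
Qed.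

Lemma belowI a b : grid a -> grid b ->
  below (Order.min a b) = below a `&` below b.
Proof.
move=> ga gb; case: (leP a b) => ab.
  by rewrite setIidl//; exact: below_mono.
by rewrite setIidr//; apply: below_mono => //; exact: ltW.
Qed.

Lemma belowU a b : grid a -> grid b ->
  below (Order.max a b) = below a `|` below b.
Proof.
move=> ga gb; case: (leP a b) => ab.
  by rewrite setUidr//; exact: below_mono.
by rewrite setUidl//; apply: below_mono => //; exact: ltW.
Qed.

Lemma grid_min a b : grid a -> grid b -> grid (Order.min a b).
Proof. by case: leP. Qed.

Lemma grid_max a b : grid a -> grid b -> grid (Order.max a b).
Proof. by case: leP. Qed.

(** Intervals form a neighbourhood basis: prescribing coordinate [N] caps [b] at [q N] if the upper
    set [x] contains [q N], and otherwise raises [a] to at least [q N]. *)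
Lemma cylinder_cut_itv x N : grid bot -> (bot < +oo)%E -> exists a b,
  [/\ grid a, grid b, (bot <= a)%E, cut_itv a b x &
      cut_itv a b `<=` cylinder x N].
Proof.
move=> gbot boty; elim: N => [|N [a [b [ga gb bota xab abN]]]].
  exists bot, +oo%E; split=> //; first exact: grid_pinfty.
  by split; rewrite ?below_pinfty//= (below_bot boty).
have [xa xb] := xab.
have step a' b' : cut_itv a' b' `<=` cut_itv a b ->
    (forall y, cut_itv a' b' y -> sval x N = sval y N) ->
    cut_itv a' b' `<=` cylinder x N.+1.
  move=> sub eqN y ya'b' n; rewrite ltnS leq_eqVlt => /predU1P[->|nN].
    exact: eqN.
  exact: abN (sub _ ya'b') _ nN.
have [xN|xN] := boolP (sval x N).
  exists a, (Order.min b (q N)%:E); split=> //.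
  - by apply: grid_min => //; exact: grid_q.
  - rewrite /cut_itv belowI//; last exact: grid_q.
    by split=> //; split=> //; exact/below_q.
  - apply: step; rewrite /cut_itv belowI//; try exact: grid_q.
      by move=> y [[]].
    by move=> y [[_ /below_q ->]].
exists (Order.max a (q N)%:E), b; split=> //.
- by apply: grid_max => //; exact: grid_q.
- by rewrite le_max bota.
- rewrite /cut_itv belowU//; last exact: grid_q.
  by split=> // -[//|/below_q]; apply/negP.
- apply: step; rewrite /cut_itv belowU//; try exact: grid_q.
    by move=> y [yb yaq]; split=> // ya; apply: yaq; left.
  move=> y [yb yaq]; rewrite (negbTE xN); apply/esym/negbTE/negP => yN.
  by apply: yaq; right; exact/below_q.
Qed.

End cut_interval.

Lemma lte_exists_reals (R : realType) (a b : \bar R) : (a < b)%E ->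
  exists s t : R, [/\ (a <= s%:E)%E, s < t & (t%:E < b)%E].
Proof.
case: a => [a| |]; case: b => [b| |] //.
- rewrite lte_fin => ab; exists a, ((a + b) / 2).
  by split; rewrite ?lee_fin ?lte_fin; lra.
- by exists a, (a + 1); split; rewrite ?ltry//; lra.
- by exists (b - 2), (b - 1); split; rewrite ?leNye ?lte_fin//; lra.
- by exists 0, 1; split; rewrite ?leNye ?ltry.
Qed.

(** * Cuts along a dense subgroup: perfectness, non-atomicity and goodness *)

Section cut_space.
Context {R : realType} (q : nat -> R) (bot : \bar R).
Hypothesis q0 : exists n, q n = 0.
Hypothesis qB : forall m n, exists k, q k = q m - q n.
Hypothesis qdense : forall s t, s < t -> exists n, s < q n < t.
Hypothesis botE : bot = -oo%E \/ bot = 0%:E.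
Local Notation X := (cuts q bot).
Local Notation mu := (@cut_measure R q bot).
Local Notation itv := (@cut_itv R q bot).
Local Notation below := (@below R q bot).
Local Notation grid := (grid q).
Implicit Types (x y z : X) (a b : \bar R).

Lemma qD m n : exists k, q k = q m + q n.
Proof.
have [i qi] := q0; have [j qj] := qB i n; have [k qk] := qB m j.
by exists k; rewrite qk qj qi; lra.
Qed.

Lemma grid_bot : grid bot.
Proof.
case: botE => ->; first exact: grid_ninfty.
by have [n <-] := q0; exact: grid_q.
Qed.

Lemma bot_lty : (bot < +oo)%E.
Proof. by case: botE => ->; rewrite ?ltNyy ?ltry. Qed.

Lemma measurable_cut_itv a b : measurable (itv a b : set (borel X)).
Proof. by apply: clopen_measurable; exact: clopen_cut_itv. Qed.

Lemma itv_botT : itv bot +oo%E = setT.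
Proof. by rewrite /cut_itv below_pinfty (below_bot q bot_lty)// setD0. Qed.

Lemma open_itv x (U : set X) : open U -> U x -> exists a b,
  [/\ grid a, grid b, (bot <= a)%E, itv a b x & itv a b `<=` U].
Proof.
rewrite openE => /[apply] /nbhs_cylinderP[N NU].
have [a [b [ga gb ba abx abN]]] := cylinder_cut_itv x N grid_bot bot_lty.
by exists a, b; split=> //; exact: subset_trans NU.
Qed.

(** If [x] were isolated, a whole interval would reduce to [x]. Two reals [s < t] inside it would
    then have the same cut, but a group element between them tells their cuts apart. *)
Lemma cuts_perfect : perfect_set [set: X].
Proof.
apply/perfectTP => x ox.
have [a [b [ga gb ba abx abU]]] := open_itv ox (erefl x).
have [s [t [as_ st tb]]] := lte_exists_reals (cut_itv_lt ga abx).
have [n /andP[sn nt]] := qdense st.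
have sx : cut_at q bot s = x.
  apply/abU/cut_itv_cut_at => //; first exact: le_trans as_.
  by rewrite as_ (le_lt_trans _ tb)// lee_fin ltW.
have at_ : (a <= t%:E)%E by rewrite (le_trans as_)// lee_fin ltW.
have tx : cut_at q bot t = x.
  apply/abU/cut_itv_cut_at => //; first exact: le_trans at_.
  by rewrite at_.
have : below (q n)%:E (cut_at q bot s : X).
  by apply/below_cut_at; [exact: le_trans as_|exact: grid_q|rewrite lte_fin].
rewrite sx -tx => /below_cut_at.
rewrite /base /= (le_trans ba at_) lte_fin => /(_ isT (grid_q _ _)).
by rewrite ltNge (ltW nt).
Qed.

Lemma cuts_cantor_like : cantor_like X.
Proof.
split; [exact: cuts_perfect|exact: cuts_compact|exact: (@metric_hausdorff R)|].
exact: cuts_zero_dimensional.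
Qed.

Lemma cut_measure_full : full mu.
Proof.
move=> U oU [x Ux]; have [a [b [ga gb ba abx abU]]] := open_itv oU Ux.
apply: (@lt_le_trans _ _ (mu (itv a b))).
  have ab := cut_itv_lt ga abx.
  by rewrite cut_measure_itv// ab sube_gt0.
apply: le_measure => //; rewrite inE; first exact: measurable_cut_itv.
exact: sub_sigma_algebra.
Qed.

Lemma cut_measureT : mu setT = +oo%E.
Proof.
rewrite -itv_botT cut_measure_itv//; [|exact: grid_bot|exact: grid_pinfty].
by rewrite bot_lty; case: botE => ->.
Qed.

(** The left endpoint is raised to [bot] so that [cut_measure_itv] applies. *)
Definition small_itv m n : set X := itv (Order.max (q m)%:E bot) (q n)%:E.

Lemma small_itv_cut_at (t e : R) : base bot t -> 0 < e ->
  exists m n, q n - q m < e /\ small_itv m n (cut_at q bot t).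
Proof.
move=> bt e0.
have [m /andP[m1 m2]] := qdense (ltac:(lra) : t - e / 2 < t).
have [n /andP[n1 n2]] := qdense (ltac:(lra) : t < t + e / 2).
exists m, n; split; first by lra.
apply/cut_itv_cut_at => //; [|exact: grid_q|].
  by apply: grid_max; [exact: grid_q|exact: grid_bot].
by rewrite ge_max bt lee_fin lte_fin n1 (ltW m2).
Qed.

Lemma cut_measure_small_itv m n (e : R) : 0 < e -> q n - q m < e ->
  (mu (small_itv m n) <= e%:E)%E.
Proof.
move=> e0 mne; rewrite cut_measure_itv.
- case: ifP => _; last by rewrite lee_fin ltW.
  apply: (@le_trans _ _ ((q n)%:E - (q m)%:E)%E).
    by apply: leeB; rewrite ?le_max lexx.
  by rewrite -EFinB lee_fin ltW.
- by apply: grid_max; [exact: grid_q|exact: grid_bot].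
- exact: grid_q.
- by rewrite le_max lexx orbT.
Qed.

(* Cuts that lie in no small interval are not in the image of [cut_at]. *)
Lemma cut_measure_null (e : R) (A : set (borel X)) : 0 < e ->
  (forall m n, q n - q m < e -> A `&` small_itv m n = set0) -> mu A = 0%E.
Proof.
move=> e0 A0; rewrite cut_measureE (_ : _ `&` _ = set0) ?measure0//.
apply/seteqP; split=> t // [At bt].
have [m [n [mne tmn]]] := small_itv_cut_at bt e0.
by have := A0 _ _ mne; rewrite -subset0 => /(_ (cut_at q bot t)); apply.
Qed.

(** Choose a real [e] with [0 < e < mu A]. An atom [A] meets each of the countably many intervals of
    length below [e] in measure less than [mu A], hence in measure 0; what remains of [A] avoids all
    these intervals and is null too. *)
Lemma cut_measure_nonatomic : nonatomic mu.
Proof.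
move=> A [mA muA_gt0 atomA]; have A0 : (0 < mu A)%E := muA_gt0.
have [e e0 eA] : exists2 e : R, 0 < e & (e%:E < mu A)%E.
  move: A0; case: (mu A) => [r| |]//.
    by rewrite lte_fin => r0; exists (r / 2); rewrite ?lte_fin; lra.
  by exists 1; rewrite ?ltry.
pose F k : set (borel X) := if unpickle k is Some (m, n) then
  if q n - q m < e then A `&` small_itv m n else set0 else set0.
have mF k : measurable (F k).
  rewrite /F; case: unpickle => [[m n]|//]; case: ifP => // _.
  by apply: measurableI => //; exact: measurable_cut_itv.
have F0 k : mu (F k) = 0%E.
  rewrite /F; case: unpickle => [[m n]|//].
  case: ifP => mn; last exact: measure0.
  have mAmn : measurable (A `&` small_itv m n : set (borel X)).
    by apply: measurableI => //; exact: measurable_cut_itv.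
  apply: atomA => //; apply: le_lt_trans eA.
  apply: le_trans (cut_measure_small_itv e0 mn).
  by apply: le_measure; rewrite ?inE//; exact: measurable_cut_itv.
have mUF : measurable (\bigcup_k F k) by exact: bigcup_measurable.
have UF0 : mu (\bigcup_k F k) = 0%E.
  apply: measure_negligible => //; apply: negligible_bigcup => k.
  by exists (F k); split; [exact: mF|exact: F0|].
have AUF0 : mu (A `\` \bigcup_k F k) = 0%E.
  apply: (cut_measure_null e0) => m n mn; rewrite -subset0 => x [[Ax nFx] xmn].
  by apply: nFx; exists (pickle (m, n)) => //; rewrite /F pickleK mn.
have : mu.-negligible A.
  apply: (@negligibleS _ _ _ _ ((\bigcup_k F k) `|` (A `\` \bigcup_k F k))).
    by move=> x Ax; have [|] := pselect ((\bigcup_k F k) x); [left|right].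
  apply: negligibleU; last first.
    exists (A `\` \bigcup_k F k); split; [|exact: AUF0|by []].
    exact: measurableD.
  by exists (\bigcup_k F k); split; [exact: mUF|exact: UF0|].
by move/(measure_negligible mA) => muA0; rewrite [mu _]muA0 ltxx in A0.
Qed.

(** Small intervals are clopen of finite measure, so no defective point lies in any of them. *)
Lemma cut_measure_nondefective : nondefective mu.
Proof.
apply: (cut_measure_null ltr01) => m n mn; rewrite -subset0 => x [dx xmn].
have := cut_measure_small_itv ltr01 mn.
by rewrite [mu _](dx _ (clopen_cut_itv _ _ _ _) xmn) leNgt ltry.
Qed.

(** The induction invariant behind both goodness and the clopen values; unlike goodness, it concerns
    one set at a time and survives disjoint unions. *)
Definition divisible (V : set X) := [/\ clopen V,
  (mu V < +oo)%E -> exists n, mu V = (q n)%:E &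
  forall n, 0 <= q n -> ((q n)%:E <= mu V)%E ->
    exists W, [/\ clopen W, W `<=` V & mu W = (q n)%:E]].

Lemma cut_measure_itv_q m k : (bot <= (q m)%:E)%E -> q m <= q k ->
  mu (itv (q m)%:E (q k)%:E) = (q k - q m)%:E.
Proof.
move=> bm mk; rewrite cut_measure_itv//; try exact: grid_q.
move: mk; rewrite le_eqVlt => /predU1P[->|mk]; last by rewrite lte_fin mk EFinB.
by rewrite ltxx subrr.
Qed.

(** A piece of length [q n] is placed at a finite end of the interval, or starts at 0 when both ends
    are infinite. Its endpoints stay in the group. *)
Lemma divisible_itv a b : grid a -> grid b -> (bot <= a)%E ->
  divisible (itv a b).
Proof.
move=> ga gb ba; have muab := cut_measure_itv ga gb ba.
have cab : clopen (itv a b) := clopen_cut_itv _ _ _ _.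
have [ab|ab] := ltP a b; last first.
  rewrite ltNge ab /= in muab; split=> //.
    by move=> _; have [n qn] := q0; exists n; rewrite muab qn.
  move=> n n0; rewrite muab lee_fin => n0'; exists set0.
  split; [exact: clopen0|by []|].
  by rewrite measure0; congr EFin; apply/eqP; rewrite eq_le n0 n0'.
have sub_itv m k : (a <= (q m)%:E)%E -> ((q k)%:E <= b)%E ->
    itv (q m)%:E (q k)%:E `<=` itv a b.
  move=> am kb x [xk xm]; split; first exact: below_mono kb _ xk.
  by move=> xa; apply: xm; apply: below_mono am _ xa; exact: grid_q.
have piece m k n : q k - q m = q n -> 0 <= q n -> (a <= (q m)%:E)%E ->
    ((q k)%:E <= b)%E ->
    exists W, [/\ clopen W, W `<=` itv a b & mu W = (q n)%:E].
  move=> kmn n0 am kb; exists (itv (q m)%:E (q k)%:E).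
  split; [exact: clopen_cut_itv|exact: sub_itv|].
  by rewrite cut_measure_itv_q ?kmn ?(le_trans ba)//; lra.
rewrite ab in muab; split=> //; rewrite muab.
  case: ga ab => [->|->|[m ->]]; case: gb => [->|->|[k ->]] // _ _.
  by have [n nE] := qB k m; exists n; rewrite nE EFinB.
move=> n n0 nab.
case: ga ab nab piece {muab cab sub_itv ba} => [->|->|[m ->]];
  case: gb => [->|->|[l ->]] // _ nab piece.
- have [m m0] := q0; apply: (piece m n); rewrite ?m0 ?subr0 ?leNye ?leey//.
- have [m mE] := qB l n; apply: (piece m l); rewrite ?leNye ?lexx// mE; lra.
- by have [k kE] := qD m n; apply: (piece m k); rewrite ?lexx ?leey// kE; lra.
- have [k kE] := qD m n; apply: (piece m k); rewrite ?lexx ?kE//; first by lra.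
  by move: nab; rewrite -EFinB !lee_fin; lra.
Qed.

(** [V1] is filled first. If it is too small, its measure is finite and hence in the group, so the
    remainder is again some [q k], to be found in [V2]. *)
Lemma divisibleU (V1 V2 : set X) : V1 `&` V2 = set0 ->
  divisible V1 -> divisible V2 -> divisible (V1 `|` V2).
Proof.
move=> V120 [c1 f1 d1] [c2 f2 d2].
have muU (W1 W2 : set X) : clopen W1 -> clopen W2 -> W1 `<=` V1 -> W2 `<=` V2 ->
    mu (W1 `|` W2) = (mu W1 + mu W2)%E.
  move=> cW1 cW2 WV1 WV2; apply: measureU; try exact: clopen_measurable.
  by apply: subsetI_eq0 V120.
have muV := muU _ _ c1 c2 (@subset_refl _ _) (@subset_refl _ _).
split; first exact: clopenU.
  rewrite muV => V12oo.
  have /f1[m mE] : (mu V1 < +oo)%E.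
    by apply: le_lt_trans V12oo; rewrite leeDl.
  have /f2[n nE] : (mu V2 < +oo)%E.
    by apply: le_lt_trans V12oo; rewrite leeDr.
  by have [k kE] := qD m n; exists k; rewrite mE nE kE.
move=> n n0; rewrite muV => nV.
have [nV1|nV1] := leP (q n)%:E (mu V1).
  have [W [cW WV1 Wn]] := d1 _ n0 nV1.
  by exists W; split=> //; apply: subset_trans WV1 _; left.
have [m mE] := f1 (lt_le_trans nV1 (leey _)).
have [k kE] := qB n m.
move: nV1 nV; rewrite mE lte_fin => mn nV.
have [||W [cW WV2 Wk]] := d2 k; first by rewrite kE; lra.
  by rewrite kE EFinB leeBlDl.
exists (V1 `|` W); split; [exact: clopenU|by apply: setUS|].
by rewrite muU// mE Wk kE -EFinD; congr EFin; lra.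
Qed.

(** Splitting the interval at [q n] makes coordinate [n] constant on both halves, which removes [n]
    from [s]. Once [s] is empty, [V] contains the whole interval or misses it. *)
Lemma divisible_finite_coords (s : seq nat) a b (V : set X) :
  grid a -> grid b -> (bot <= a)%E ->
  (forall x y, itv a b x -> itv a b y ->
    (forall n, n \in s -> sval x n = sval y n) -> V x -> V y) ->
  divisible (V `&` itv a b).
Proof.
elim: s a b => [|n s ih] a b ga gb ba Vs.
  have [[x [Vx xab]]|Vab] := pselect (V `&` itv a b !=set0).
    rewrite setIidr; first exact: divisible_itv.
    by move=> y yab; apply: (Vs x).
  rewrite (_ : V `&` itv a b = itv a a); first exact: divisible_itv.
  rewrite /cut_itv setDv; apply/seteqP; split=> x // Vx.
  by apply: Vab; exists x.
have gn := grid_q q n.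
have itv1 : itv a (Order.min b (q n)%:E) = itv a b `&` below (q n)%:E.
  by rewrite /cut_itv belowI// !setDE setIAC.
have itv2 : itv (Order.max a (q n)%:E) b = itv a b `\` below (q n)%:E.
  by rewrite /cut_itv belowU// setDDl.
have -> : V `&` itv a b = (V `&` itv a (Order.min b (q n)%:E)) `|`
                         (V `&` itv (Order.max a (q n)%:E) b).
  by rewrite -setIUr itv1 itv2 setUIDK.
apply: divisibleU.
- by rewrite itv1 itv2; apply/seteqP; split=> x // [[_ [_ ?]] [_ []]].
- apply: ih => //; first exact: grid_min.
  rewrite itv1 => x y [xab /below_q xn] [yab /below_q yn] xy; apply: Vs => // m.
  by rewrite inE => /predU1P[->|]; [rewrite xn yn|exact: xy].
- apply: ih => //; [exact: grid_max|by rewrite le_max ba|].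
  rewrite itv2 => x y [xab xn] [yab yn] xy; apply: Vs => // m.
  rewrite inE => /predU1P[->|]; last exact: xy.
  transitivity false; last apply/esym; by apply/negP => /below_q.
Qed.

Lemma clopen_divisible (V : set X) : clopen V -> divisible V.
Proof.
move=> /clopen_finite_coords[N VN].
rewrite -(setIT V) -itv_botT; apply: (@divisible_finite_coords (iota 0 N)).
- exact: grid_bot.
- exact: grid_pinfty.
- by [].
- move=> x y _ _ xy Vx; apply: VN Vx _ => n nN.
  by apply: xy; rewrite mem_iota.
Qed.

Lemma cut_measure_good : good mu.
Proof.
move=> U V cU cV; rewrite -[Measure.sort _]/mu => UV.
have [_ fU _] := clopen_divisible cU; have [_ _ dV] := clopen_divisible cV.
have [n nE] := fU (lt_le_trans UV (leey _)).
have n0 : 0 <= q n by rewrite -lee_fin -nE.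
by rewrite nE; apply: dV => //; rewrite -nE ltW.
Qed.

Lemma cut_measure_clopen_values :
  clopen_values mu = [set d | 0 <= d /\ range q d].
Proof.
apply/seteqP; split=> [d [U [cU Uoo] <-]|d [+ [n _ nd]]]; last rewrite -nd.
  have [_ /(_ Uoo)[n nE] _] := clopen_divisible cU.
  rewrite [X in fine X]nE; split; last by exists n.
  by rewrite -lee_fin -nE.
(* The whole space has infinite measure, so it contains clopen sets of every measure [q n >= 0]. *)
move=> n0; have [_ _ /(_ n n0)] := clopen_divisible (@clopenT X).
rewrite cut_measureT leey => /(_ isT)[W [cW _ WE]].
exists W; last by rewrite [X in fine X]WE.
by split=> //; rewrite [X in (X < _)%E]WE ltry.
Qed.

Lemma cut_measure_M_infty : M_infty mu.
Proof.
split; [exact: cut_measure_full|exact: cut_measure_nonatomic|].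
exact: cut_measureT.
Qed.

End cut_space.

(** * Defective points of the half-line and of the line *)

Section defective_points.
Context {R : realType} (q : nat -> R).
Hypothesis q0 : exists n, q n = 0.

(** A cut whose upper set contains [q n] lies in the clopen interval from 0 to [q n], of finite
    length; only the empty upper set escapes. *)
Lemma defective_set_half_line :
  defective_set (@cut_measure R q 0%:E) `<=` [set cut_top q 0%:E].
Proof.
move=> x dx; apply: cut_eqP => n; apply/negP => xn.
have : (@cut_measure R q 0%:E (@below R q 0%:E (q n)%:E) < +oo)%E.
  rewrite (_ : below _ = @cut_itv R q 0%:E 0%:E (q n)%:E).
    rewrite cut_measure_itv//; last exact: grid_q.
      by case: ifP; rewrite ?ltry// -EFinB ltry.
    by have [k <-] := q0; exact: grid_q.
  by rewrite /cut_itv (below_bot q (ltry 0) (lexx _)) setD0.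
have xbn : below (q n)%:E x by exact/below_q.
by rewrite [cut_measure _](dx _ (clopen_below _ _ _) xbn) ltxx.
Qed.

Lemma cut_bottom_subproof : is_cut q -oo%E (fun=> true).
Proof. by split=> // n; rewrite leeNy_eq. Qed.

Definition cut_bottom : cuts q -oo%E := exist _ _ cut_bottom_subproof.

(** [c = false] is the end [+oo] and [c = true] the end [-oo]. An interval around either has that
    infinite endpoint, since every [q n] lies on the same side of [x]. *)
Lemma defective_set_line (x : cuts q -oo%E) (c : bool) :
  (forall n, sval x n = c) -> defective_set (@cut_measure R q -oo%E) x.
Proof.
move=> xc U cU Ux.
have [a [b [ga gb _ [xb xa] abU]]] := open_itv q0 (or_introl erefl) cU.1 Ux.
have muab := cut_measure_itv ga gb (leNye a).
have ab : (a < b)%E by apply: (@cut_itv_lt _ q -oo%E a b x).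
have muoo : @cut_measure R q -oo%E (@cut_itv R q -oo%E a b) = +oo%E.
  rewrite muab ab; case: c xc => xc.
    case: ga xa ab {abU muab xb} => [->|->|[n ->]].
    - by case: gb => [->|->|[n ->]].
    - by rewrite below_pinfty => xa; exfalso; apply: xa.
    - by move=> xa; exfalso; apply: xa; apply/below_q; rewrite xc.
  case: xb ab {gb abU muab} => [->|[n _]]; last by rewrite xc.
  by case: ga {xa} => [->|->|[n ->]].
apply/eqP; rewrite -leye_eq -muoo; apply: le_measure => //; rewrite inE.
  by apply: measurable_cut_itv.
by apply: clopen_measurable.
Qed.

End defective_points.

Section defective_homeomorphism.
Context {R : realType} (X1 X2 : ptopologicalType).
Variables (mu1 : {measure set (borel X1) -> \bar R})
  (mu2 : {measure set (borel X2) -> \bar R}).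

Lemma defective_set_homeomorphism (h : X1 -> X2) (g : X2 -> X1) :
  cancel h g -> cancel g h -> continuous g ->
  (forall A : set (borel X2), measurable A ->
    pushforward mu1 (h : borel X1 -> borel X2) A = mu2 A) ->
  defective_set mu2 `<=` g @^-1` defective_set mu1.
Proof.
move=> hK gK cg hmu y dy U cU Ugy.
have cgU : clopen (g @^-1` U) by exact: preimage_clopen.
rewrite -(dy _ cgU Ugy) -hmu; last by apply: sub_sigma_algebra; exact: cgU.1.
by rewrite /pushforward -comp_preimage (_ : g \o h = id)//; exact/funext.
Qed.

End defective_homeomorphism.

(** * From a group-like set to an enumerated dense subgroup *)

Section group_like_enumeration.
Context {R : realType} (D : set R).
Hypothesis hD : group_like D.

Lemma group_like_ge0 d : D d -> 0 <= d.
Proof. by case: hD => D0 _ _ _ _ /D0; rewrite /= in_itv /= andbT. Qed.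

Lemma group_like_unbounded (r : R) : exists2 d, D d & r < d.
Proof.
apply: contrapT => nr; case: hD => _ _ _ + _; apply; exists r => d Dd.
by rewrite leNgt; apply/negP => rd; apply: nr; exists d.
Qed.

(** Local subgroups are given at points of [D] only; unboundedness supplies such a point beyond
    [r]. *)
Lemma group_like_local (r : R) : exists2 G : {pred R}, zmod_closed G &
  forall x, 0 <= x <= r -> D x <-> x \in G.
Proof.
have [d Dd rd] := group_like_unbounded r.
case: hD => _ _ _ _ /(_ _ Dd)[G Gz DG]; exists G => // x /andP[x0 xr].
have xd : x \in `[0, d] by rewrite in_itv /= x0 (le_trans xr (ltW rd)).
split=> [Dx|Gx].
  by have : (D `&` `[0, d]) x by []; rewrite DG => -[].
by have : ([set` G] `&` `[0, d]) x by []; rewrite -DG => -[].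
Qed.

Lemma group_like0 : D 0.
Proof.
have [G [G0 _] DG] := group_like_local 0.
by apply/DG => //; rewrite lexx.
Qed.

Lemma group_likeB x y : D x -> D y -> 0 <= x - y -> D (x - y).
Proof.
move=> Dx Dy xy0; have [G [_ GB] DG] := group_like_local x.
have [x0 y0] := (group_like_ge0 Dx, group_like_ge0 Dy).
apply/DG; first by lra.
by apply: GB; apply/DG => //; lra.
Qed.

(** The subgroup varies with the bound, so it is taken at [x + y], where it covers both terms and
    their sum. *)
Lemma group_likeD x y : D x -> D y -> D (x + y).
Proof.
move=> Dx Dy; have [G [G0 GB] DG] := group_like_local (x + y).
have [x0 y0] := (group_like_ge0 Dx, group_like_ge0 Dy).
apply/DG; first by lra.
have -> : x + y = x - (0 - y) by lra.
by apply: (GB); [|apply: (GB) => //]; apply/DG => //; lra.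
Qed.

Lemma group_like_dense (s t : R) : 0 <= s -> s < t ->
  exists2 d, D d & s < d < t.
Proof.
move=> s0 st; case: hD => _ _ + _ _ => /(_ ((s + t) / 2)).
have e0 : 0 < (t - s) / 2 by lra.
rewrite /= in_itv /= andbT => /(_ ltac:(lra) _ (nbhsx_ballx _ _ e0))[d [Dd]].
rewrite /ball /= ltr_distlC => /andP[sd dt].
by exists d => //; apply/andP; split; lra.
Qed.

Lemma group_like_enum : exists q : nat -> R,
  [/\ exists n, q n = 0,
      forall m n, exists k, q k = q m - q n,
      forall s t, s < t -> exists n, s < q n < t &
      [set d | 0 <= d /\ range q d] = D].
Proof.
have /pfcard_geP[D0|[f]] : countable D by case: hD.
  by have := group_like0; rewrite D0.
(* Enumerates [D - D] through pairs of indices; the default 0 also belongs to it. *)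
pose q k := if unpickle k is Some (m, n) then f m - f n else 0.
have qE x y : D x -> D y -> exists k, q k = x - y.
  move=> /(@surj _ _ _ _ f)[m _ <-] /(@surj _ _ _ _ f)[n _ <-].
  by exists (pickle (m, n)); rewrite /q pickleK.
have Df n : D (f n) by exact: funS.
have qD k : exists x y, [/\ D x, D y & q k = x - y].
  rewrite /q; case: unpickle => [[m n]|]; first by exists (f m), (f n).
  by exists 0, 0; rewrite subrr; split=> //; exact: group_like0.
exists q; split.
- by have [k kE] := qE _ _ group_like0 group_like0; exists k; rewrite kE subrr.
- move=> m n; have [x [y [Dx Dy ->]]] := qD m; have [z [w [Dz Dw ->]]] := qD n.
  (* Regroups [(x - y) - (z - w)] as [(x + w) - (y + z)]. *)
  have [k kE] := qE _ _ (group_likeD Dx Dw) (group_likeD Dy Dz).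
  by exists k; rewrite kE; lra.
- move=> s t st; have [d Dd sd] := group_like_unbounded (- s).
  (* Translation by [d] moves the gap into the half-line, where [D] is dense. *)
  have [|| e De /andP[se et]] := @group_like_dense (s + d) (t + d); try lra.
  have [k kE] := qE _ _ De Dd.
  by exists k; rewrite kE; apply/andP; split; lra.
- apply/seteqP; split=> [d [d0 [k _ kd]]|d Dd].
    have [x [y [Dx Dy kE]]] := qD k.
    by rewrite -kd kE; apply: group_likeB => //; rewrite -kE kd.
  split; first exact: group_like_ge0.
  by have [k kE] := qE _ _ Dd group_like0; exists k => //; rewrite kE subr0.
Qed.

End group_like_enumeration.

Theorem corollary2p16 (R : realType) (D : set R) (hD : group_like D) :
  exists (X1 X2 : pmetricType R)
    (mu1 : {measure set (borel X1) -> \bar R})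
    (mu2 : {measure set (borel X2) -> \bar R}),
    [/\ cantor_like X1 /\ cantor_like X2,
        M_infty mu1 /\ M_infty mu2,
        nondefective mu1 /\ nondefective mu2,
        good mu1 /\ good mu2 &
        [/\ clopen_values mu1 = D, clopen_values mu2 = D &
            ~ homeomorphic_measures mu1 mu2]].
Proof.
have [q [q0 qB qdense qD]] := group_like_enum hD.
have b1 : (0 : R)%:E = -oo%E \/ (0 : R)%:E = 0%:E by right.
have b2 : (-oo : \bar R)%E = -oo%E \/ (-oo : \bar R)%E = 0%:E by left.
exists (cuts q 0%:E), (cuts q -oo%E), (@cut_measure R q 0%:E),
  (@cut_measure R q -oo%E).
split.
- by split; exact: cuts_cantor_like.
- by split; exact: cut_measure_M_infty.
- by split; exact: cut_measure_nondefective.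
- by split; exact: cut_measure_good.
split; [by rewrite cut_measure_clopen_values..|].
move=> [h [[ch [g [hK gK cg]]] hmu]].
have dg := @defective_set_homeomorphism _ _ _ _ _ h g hK gK cg hmu.
(* Both ends of the line go to the only possible defective point of the half-line, against
   injectivity of [g]; the two ends already differ at coordinate 0. *)
have : g (cut_top q -oo%E) = g (cut_bottom q).
  have d1 := dg _ (@defective_set_line _ _ q0 (cut_top q _) false (fun=> erefl)).
  have d2 := dg _ (@defective_set_line _ _ q0 (cut_bottom q) true (fun=> erefl)).
  by rewrite (defective_set_half_line q0 d1) (defective_set_half_line q0 d2).
by move=> /(can_inj gK)/(congr1 (fun x => sval x 0%N)).
Qed.
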